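(* Let $T\ge 1$, $u\ge 1$, $v\ge 0$ and $0\le\Delta\le T$ be integers, let $R=\frac{u+v}{2u+v}$, and assume $R\ge\frac12$ and $\Delta\ge R(T+1)$. Consider the Embedded-Random Linear Code with shift $\Delta$ and parameters $(u,v,T)$ over $\mathbb{F}_q$, whose coefficient matrices have entries sampled uniformly at random from $\mathbb{F}_q$. Then, with high probability for $q$ sufficiently large, the column distance of the code is $$d_T=\frac{1-R}{R}(T-\Delta)+2.$$
   Context: Embedded-Random Linear Code with shift $\Delta$ and parameters $(u,v,T)$: each source packet at time $i\ge 0$ is $\mathbf{s}[i]=(\mathbf{u}[i],\mathbf{v}[i])$ with $\mathbf{u}[i]\in\mathbb{F}_q^u$ and $\mathbf{v}[i]\in\mathbb{F}_q^v$ (row vectors; all symbols at negative times are zero). Given matrices $\mathbf{G}_1,\dots,\mathbf{G}_{T-1}\in\mathbb{F}_q^{v\times u}$ and $\mathbf{H}_0,\dots,\mathbf{H}_{T-\Delta}\in\mathbb{F}_q^{u\times u}$, define the parity checks $$\mathbf{p}_v[i]=\sum_{j=1}^{T-1}\mathbf{v}[i-j]\,\mathbf{G}_j,\qquad \mathbf{p}_u[i]=\sum_{j=0}^{T-\Delta}\mathbf{u}[i-j]\,\mathbf{H}_j,$$ both in $\mathbb{F}_q^u$. The channel packet at time $i$ is $$\mathbf{x}[i]=\big(\mathbf{u}[i],\ \mathbf{v}[i],\ \mathbf{p}_v[i]+\mathbf{p}_u[i-\Delta]\big)\in\mathbb{F}_q^{2u+v}.$$ The rate is $R=\frac{u+v}{2u+v}$.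 The entries of all the $\mathbf{G}_j$ and $\mathbf{H}_j$ are sampled uniformly at random from $\mathbb{F}_q$, and $q$ is assumed sufficiently large that, with high probability, all sub-matrices of interest (those arising in the erasure-decoding linear systems) have full row rank or full column rank. Column distance: for source packets $\mathbf{s}[0],\dots,\mathbf{s}[T]$ let $[\mathbf{x}[0],\dots,\mathbf{x}[T]]$ be the corresponding first $T+1$ channel packets, and let the weight of this sequence be the number of time indices in $\{0,\dots,T\}$ at which the channel packet is nonzero. Then $d_T$ is the minimum of the weight over all $\mathbf{s}[0],\dots,\mathbf{s}[T]$ with $\mathbf{s}[0]\ne 0$.
   Formalization: The formula for d_T is replaced by its integer part, since the column distance is an integer while (1-R)/R(T-Δ)+2 need not be (u=v=1, T=5, Δ=4 gives 2.5); whenever the right-hand side is an integer the claim is the stated equality. *)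

(* Defs.v *)
From HB Require Import structures.
From mathcomp Require Import all_boot all_order all_algebra.

Set Implicit Arguments.
Unset Strict Implicit.
Unset Printing Implicit Defensive.
Import Order.TTheory GRing.Theory Num.Theory.
Local Open Scope ring_scope.

Definition rate (u v : nat) : rat := (u + v)%:R / (2 * u + v)%:R.

(* A source packet (u[i], v[i]). *)
Definition packet (F : finFieldType) (u v : nat) : Type :=
  ('rV[F]_u * 'rV[F]_v)%type.

(* The matrices (G_1, ..., G_{T-1}) and (H_0, ..., H_{T-Delta}).  The first
   family is indexed from 0: its entry at j : 'I_T.-1 is G_{j+1}. *)
Definition erlc (F : finFieldType) (T u v Delta : nat) : Type :=
  ({ffun 'I_T.-1 -> 'M[F]_(v, u)} * {ffun 'I_(T - Delta).+1 -> 'M[F]_u})%type.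

Section Encoder.
Variables (F : finFieldType) (T u v Delta : nat) (c : erlc F T u v Delta).

(* Times range over int, so that i - j and i - Delta are true subtractions. *)
Variable s : int -> packet F u v.

Definition parity_v (i : int) : 'rV[F]_u :=
  \sum_(j < T.-1) (s (i - j.+1%:Z)).2 *m c.1 j.

Definition parity_u (i : int) : 'rV[F]_u :=
  \sum_(j < (T - Delta).+1) (s (i - j%:Z)).1 *m c.2 j.

Definition channel_packet (i : int) : 'rV[F]_(u + v + u) :=
  row_mx (row_mx (s i).1 (s i).2) (parity_v i + parity_u (i - Delta%:Z)).

End Encoder.

(* The packets s[0], ..., s[T], preceded by zeros at negative times.  They are
   also followed by zeros, which is immaterial: by causality x[0], ..., x[T] do
   not depend on later source packets. *)
Definition source_stream (F : finFieldType) (T u v : nat)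
    (s : {ffun 'I_T.+1 -> packet F u v}) (i : int) : packet F u v :=
  if i is Posz n then oapp s 0 (insub n) else 0.

Definition weight (F : finFieldType) (T u v Delta : nat)
    (c : erlc F T u v Delta) (s : {ffun 'I_T.+1 -> packet F u v}) : nat :=
  #|[set i : 'I_T.+1 | channel_packet c (source_stream s) i%:Z != 0]|.

(* The default value T.+1 of the minimum bounds every weight, so it does not
   affect the minimum as soon as some s with s[0] != 0 exists (0 < u + v). *)
Definition column_distance (F : finFieldType) (T u v Delta : nat)
    (c : erlc F T u v Delta) : nat :=
  \big[minn/T.+1]_(s : {ffun 'I_T.+1 -> packet F u v} | s ord0 != 0)
    weight c s.

(* For X = erlc F T u v Delta, this makes all matrix entries independent and
   uniform in F. *)
Definition uniform_prob (X : finType) (A : pred X) : rat := #|A|%:R / #|X|%:R.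

(* Main.v *)
(* Each s with s[0] != 0 and a prescribed set of erased times is a vector with a
   bounded number k of free symbols.  When the first nonzero v[i] and u[0] meet
   fresh coefficients at every time of a set Z, the parities of s on Z are
   uniform, hence all zero with probability q^(-u|Z|).  A union bound over the
   at most q^k candidates, counted up to scaling, shows that a nonzero candidate
   with zero parities on Z exists with probability at most
   q^(k - u|Z|) / (q - 1) <= 1 / (q - 1) as soon as k <= u|Z|; call a code
   generic when this never happens.

   Let N = floor(u(T - Delta) / (u + v)).  A generic code has no s of weight at
   most N + 1: if v[0] != 0, use the parities before Delta; otherwise let k be
   the smaller of Delta and the first time with v[k] != 0, and use all parities
   from time k on.  Conversely, with erasures at 0 and Delta, ..., Delta + N, the
   unknown u[0] and enough symbols of v[Delta], ..., v[Delta + N] outnumber the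
   remaining parity equations by one, which gives a nonzero solution; genericity
   forces u[0] != 0 in it. *)
Require Import Defs.
From HB Require Import structures.
From mathcomp Require Import all_boot all_order all_algebra.
From mathcomp Require Import zify ring.

Set Implicit Arguments.
Unset Strict Implicit.
Unset Printing Implicit Defensive.
Import Order.TTheory GRing.Theory Num.Theory.
Local Open Scope ring_scope.

(** * Parities as linear functions of the source word and of the code *)

Section Parity.
Variables (F : finFieldType) (T u v Delta : nat).
Implicit Types (c : erlc F T u v Delta).

(** One coordinate per field symbol rather than per packet, so that free symbols can be counted
    individually. *)
Definition position := ('I_T.+1 * ('I_u + 'I_v))%type.
Implicit Types (f g h : {ffun position -> F}) (Z : {set 'I_T.+1}).

Definition word f : {ffun 'I_T.+1 -> packet F u v} :=
  [ffun i => (\row_j f (i, inl j), \row_j f (i, inr j))].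

Definition parity c f (i : 'I_T.+1) : 'rV[F]_u :=
  parity_v c (source_stream (word f)) i%:Z
  + parity_u c (source_stream (word f)) (i%:Z - Delta%:Z).

Lemma word_surj (s : {ffun 'I_T.+1 -> packet F u v}) : exists f, word f = s.
Proof.
exists [ffun x => match x.2 with inl j => (s x.1).1 0 j
                               | inr j => (s x.1).2 0 j end].
apply/ffunP => i; rewrite ffunE [RHS]surjective_pairing.
by congr pair; apply/rowP => j; rewrite !mxE ffunE.
Qed.

Lemma source_stream_nat (s : {ffun 'I_T.+1 -> packet F u v}) (i : 'I_T.+1) :
  source_stream s i%:Z = s i.
Proof. by rewrite /source_stream insubT //= => lti; congr (s _); apply: val_inj. Qed.

(** Causality: the [G] part starts at lag 1, so it reads [v] strictly before [i]; the [H] part reads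
    [u] at lag at least [Delta]. *)
Lemma parity_congr c f g (i : 'I_T.+1) :
  (forall (l : 'I_T.+1) j, (l < i)%N -> f (l, inr j) = g (l, inr j)) ->
  (forall (l : 'I_T.+1) j, (l + Delta <= i)%N -> f (l, inl j) = g (l, inl j)) ->
  parity c f i = parity c g i.
Proof.
move=> eqr eql; congr (_ + _); apply: eq_bigr => j _; congr (_ *m _).
  case E: (i%:Z - _) => [n|n] //=; case: insubP => [l _ /= ln|_] //=.
  by rewrite !ffunE /=; apply/rowP => k; rewrite !mxE eqr //; lia.
case E: (_ - _ - _) => [n|n] //=; case: insubP => [l _ /= ln|_] //=.
by rewrite !ffunE /=; apply/rowP => k; rewrite !mxE eql //; lia.
Qed.

(** The shape [a * f x + g x] covers both scalings and differences of words. *)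
Lemma parity_linear c (a : F) f g h (i : 'I_T.+1) :
  (forall x, h x = a * f x + g x) ->
  parity c h i = a *: parity c f i + parity c g i.
Proof.
move=> hE; have hS z : source_stream (word h) z =
    (a *: (source_stream (word f) z).1 + (source_stream (word g) z).1,
     a *: (source_stream (word f) z).2 + (source_stream (word g) z).2).
  case: z => [n|n] /=; last by rewrite !scaler0 !addr0.
  case: insubP => [l _ _|_] /=; last by rewrite !scaler0 !addr0.
  by rewrite !ffunE /=; congr pair; apply/rowP => k; rewrite !mxE hE.
rewrite /parity /parity_v /parity_u scalerDr addrACA !scaler_sumr -!big_split /=.
by congr (_ + _); apply: eq_bigr => j _; rewrite hS /= mulmxDl scalemxAl.
Qed.

Lemma neq0_ex f : f != [ffun=> 0] -> exists x, f x != 0.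
Proof.
move=> f0; apply/existsP; apply: contraNT f0 => /existsPn f0.
by apply/eqP/ffunP => x; rewrite ffunE; apply/eqP/negPn/f0.
Qed.

Lemma parity0 c (i : 'I_T.+1) : parity c [ffun=> 0] i = 0.
Proof.
rewrite (@parity_linear c (-1) [ffun=> 0] [ffun=> 0] [ffun=> 0]).
  by rewrite scaleN1r addNr.
by move=> x; rewrite !ffunE mulr0 addr0.
Qed.

Lemma parityD c c' f i : parity (c + c') f i = parity c f i + parity c' f i.
Proof.
rewrite /parity addrACA /parity_v /parity_u -!big_split /=.
by congr (_ + _); apply: eq_bigr => j _; rewrite ffunE mulmxDr.
Qed.

(** * Surjectivity of the parities in the coefficient matrices *)

Lemma row_mulmx_onto n (w : 'rV[F]_n) (y : 'rV[F]_u) :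
  w != 0 -> exists M, w *m M = y.
Proof.
move=> w0; exists (pinvmx w *m y); rewrite mulmxA mulmxVp ?mul1mx //.
by rewrite /row_free rank_rV w0.
Qed.

(** The word is fixed and the code varies: [c] is a correction that moves the parity at [i] at will
    and disturbs none before it. *)
Definition triangular f (i : 'I_T.+1) := forall y : 'rV[F]_u, exists c,
  parity c f i = y /\ forall l : 'I_T.+1, (l < i)%N -> parity c f l = 0.

(** Only [G_{i-k}], stored at index [(i - k).-1], is taken nonzero. It meets [v[k]] at time [i], and
    before that only [v] packets earlier than [k], which vanish. *)
Lemma triangular_G f (k i : 'I_T.+1) :
    (forall (l : 'I_T.+1) j, (l < k)%N -> f (l, inr j) = 0) ->
    (exists j, f (k, inr j) != 0) -> (k < i)%N -> (i - k < T)%N ->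
  triangular f i.
Proof.
move=> f0 [j fkj] ltki ltT y.
have [M ME] : exists M, \row_j f (k, inr j) *m M = y.
  apply: row_mulmx_onto; apply: contraNneq fkj => /rowP/(_ j).
  by rewrite !mxE => ->.
have lt0 : ((i - k).-1 < T.-1)%N by lia.
pose c : erlc F T u v Delta :=
  ([ffun l => if l == Ordinal lt0 then M else 0], [ffun=> 0]).
have cE l : parity c f l =
    (source_stream (word f) (l%:Z - (i - k)%N%:Z)).2 *m M.
  rewrite /parity /parity_u [X in _ + X]big1 ?addr0; last first.
    by move=> j' _; rewrite ffunE mulmx0.
  rewrite /parity_v (bigD1 (Ordinal lt0)) //= ffunE eqxx big1 ?addr0.
    by rewrite prednK // subn_gt0.
  by move=> j' /negPf nj; rewrite ffunE nj mulmx0.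
exists c; split=> [|l ltl]; rewrite cE.
  have -> : i%:Z - (i - k)%N%:Z = k%:Z by lia.
  by rewrite source_stream_nat ffunE.
suff -> : (source_stream (word f) (l%:Z - (i - k)%N%:Z)).2 = 0 by rewrite mul0mx.
case E: (_ - _) => [n|n] //=; case: insubP => [l' _ /= ln|_] //=.
by rewrite ffunE /=; apply/rowP => j'; rewrite !mxE f0 //; lia.
Qed.

(** Only [H_{i-Delta}] is taken nonzero. It meets [u[0]] at time [i], and negative times before
    that. *)
Lemma triangular_H f (i : 'I_T.+1) :
  (exists j, f (ord0, inl j) != 0) -> (Delta <= i)%N -> triangular f i.
Proof.
move=> [j f0j] leDi y.
have [M ME] : exists M, \row_j f (ord0, inl j) *m M = y.
  apply: row_mulmx_onto; apply: contraNneq f0j => /rowP/(_ j).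
  by rewrite !mxE => ->.
have lt0 : (i - Delta < (T - Delta).+1)%N by have := ltn_ord i; lia.
pose c : erlc F T u v Delta :=
  ([ffun=> 0], [ffun l => if l == Ordinal lt0 then M else 0]).
have cE l : parity c f l =
    (source_stream (word f) (l%:Z - Delta%:Z - (i - Delta)%N%:Z)).1 *m M.
  rewrite /parity /parity_v big1 ?add0r; last by move=> j' _; rewrite ffunE mulmx0.
  rewrite /parity_u (bigD1 (Ordinal lt0)) //= ffunE eqxx big1 ?addr0 //.
  by move=> j' /negPf nj; rewrite ffunE nj mulmx0.
exists c; split=> [|l ltl]; rewrite cE.
  have -> : i%:Z - Delta%:Z - (i - Delta)%N%:Z = (ord0 : 'I_T.+1)%:Z by rewrite /=; lia.
  by rewrite source_stream_nat ffunE.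
by case E: (_ - _) => [n|n] /=; [lia | rewrite mul0mx].
Qed.

Definition onto f Z := [forall y : {ffun 'I_T.+1 -> 'rV[F]_u},
  exists c : erlc F T u v Delta, [forall i in Z, parity c f i == y i]].

(** Induction on time: the correction at time [m] preserves the parities already adjusted. *)
Lemma triangular_onto f Z : (forall i, i \in Z -> triangular f i) -> onto f Z.
Proof.
move=> tri; apply/forallP => y.
suff /(_ T.+1)[c cP] : forall m, exists c, forall i : 'I_T.+1,
    i \in Z -> (i < m)%N -> parity c f i = y i.
  by apply/existsP; exists c; apply/forall_inP => i Zi; rewrite cP.
elim=> [|m [c cP]].
  by exists 0.
have [[i [Zi im]]|nZ] :
    (exists i, i \in Z /\ nat_of_ord i = m) \/ (forall i, i \in Z -> nat_of_ord i != m).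
  have [/existsP[i /andP[Zi /eqP im]]|] :=
      boolP [exists i, (i \in Z) && (nat_of_ord i == m)].
    by left; exists i.
  rewrite negb_exists => /forallP nZ; right=> i Zi.
  by have := nZ i; rewrite Zi.
- have [c' [c'i c'l]] := tri i Zi (y i - parity c f i).
  exists (c + c') => l Zl; rewrite ltnS leq_eqVlt parityD => /orP[/eqP lm|ltl].
    have -> : l = i by apply: val_inj; rewrite /= lm im.
    by rewrite c'i addrC subrK.
  by rewrite c'l ?im // addr0 cP.
- by exists c => i Zi; rewrite ltnS leq_eqVlt (negPf (nZ i Zi)) => /cP->.
Qed.

(** * Counting the codes that are not generic *)

Definition vanishes c f Z := [forall i in Z, parity c f i == 0].

(** For each [y] supported on [Z], choose a code [sigma y] with parities [y] on [Z]. The translates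
    of the vanishing codes by these are disjoint, since the parities of a sum recover [y]. *)
Lemma card_vanishes f Z : onto f Z ->
  (#|[set c : erlc F T u v Delta | vanishes c f Z]| * #|F| ^ (u * #|Z|)
     <= #|{: erlc F T u v Delta}|)%N.
Proof.
move=> /forallP fZ.
pose Y := [set y : {ffun 'I_T.+1 -> 'rV[F]_u} | y \in pffun_on 0 Z predT].
have cardY : #|Y| = (#|F| ^ (u * #|Z|))%N.
  by rewrite cardsE card_pffun_on expnM card_mx mul1n.
have sE (y : {ffun 'I_T.+1 -> 'rV[F]_u}) :
    exists c : erlc F T u v Delta, [forall i in Z, parity c f i == y i].
  exact/existsP/fZ.
pose sigma y := xchoose (sE y).
have sigmaP y i : i \in Z -> parity (sigma y) f i = y i.
  by move=> Zi; apply/eqP; have /forall_inP := xchooseP (sE y); apply.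
rewrite -cardY -cardsX -cardsT.
pose phi (p : erlc F T u v Delta * {ffun 'I_T.+1 -> 'rV[F]_u}) : erlc F T u v Delta :=
  p.1 + sigma p.2.
rewrite -(card_in_imset (f := phi)) ?subset_leq_card ?subsetT //.
move=> [c1 y1] [c2 y2]; rewrite !inE /= => /andP[v1 Y1] /andP[v2 Y2] eq12.
suff y12 : y1 = y2 by move: eq12; rewrite /phi /= y12 => /addIr ->.
apply/ffunP => i; have [Zi|nZi] := boolP (i \in Z).
  have := congr1 (fun c => parity c f i) eq12; rewrite /phi /= !parityD !sigmaP //.
  by rewrite (eqP (forall_inP v1 i Zi)) (eqP (forall_inP v2 i Zi)) !add0r.
have out y : y \in pffun_on 0 Z predT -> y i = 0.
  by move=> /pffun_onP[/supportP sy _]; apply: sy.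
by rewrite !out.
Qed.

Definition word_supp (C : {set position}) f := [forall x, (f x != 0) ==> (x \in C)].

Lemma word_suppP (C : {set position}) f :
  reflect (forall x, x \notin C -> f x = 0) (word_supp C f).
Proof.
apply: (iffP forallP) => [fC x | fC x].
  by have := fC x; case: eqVneq => //= _ ->.
by apply/implyP; apply: contraNT => /fC ->.
Qed.

Lemma card_word_supp (C : {set position}) :
  #|[set f | word_supp C f]| = (#|F| ^ #|C|)%N.
Proof.
rewrite -(card_pffun_on 0 (mem C) (@predT F)) cardsE; apply: eq_card => f.
rewrite [RHS](_ : _ = word_supp C f) //; apply/pffun_onP/word_suppP.
  by move=> [/supportP fC _] x; apply: fC.
by move=> fC; split=> //; apply/supportP => x; apply: fC.
Qed.

(** The pair consists of the free symbols and the parity times. The size condition is built in so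
    that one bound holds for every pair. *)
Definition failures (p : {set position} * {set 'I_T.+1}) : {set erlc F T u v Delta} :=
  [set c | (#|p.1| <= u * #|p.2|)%N && [exists f : {ffun position -> F},
    [&& f != [ffun=> 0], word_supp p.1 f, onto f p.2 & vanishes c f p.2]]].

(** Double counting of pairs (code, vanishing word in [S]): a failing code has at least [#|F|.-1]
    such words, the nonzero multiples of one, while [card_vanishes] bounds the codes for each
    word. *)
Lemma card_failures p :
  (#|failures p| * #|F|.-1 <= #|{: erlc F T u v Delta}|)%N.
Proof.
have F0 : (0 < #|F|)%N by apply/card_gt0P; exists 0.
have [ltC|leC] := ltnP (u * #|p.2|) #|p.1|.
  rewrite (_ : failures p = set0) ?cards0 //; apply/setP => c.
  by rewrite !inE leqNgt ltC.
pose S : {set {ffun position -> F}} := [set f | word_supp p.1 f && onto f p.2].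
have leS : (#|S| <= #|F| ^ (u * #|p.2|))%N.
  apply: (@leq_trans (#|F| ^ #|p.1|)); last by rewrite leq_pexp2l.
  rewrite -card_word_supp; apply: subset_leq_card.
  by apply/subsetP => f; rewrite !inE => /andP[].
have q0 : (0 < #|F| ^ (u * #|p.2|))%N by rewrite expn_gt0 F0.
rewrite -(leq_pmul2r q0).
have scale c : c \in failures p ->
    (#|F|.-1 <= \sum_(f in S) (vanishes c f p.2 : nat))%N.
  rewrite inE => /andP[_ /existsP[f /and4P[f0 /word_suppP fC fZ cf]]].
  have [x fx] := neq0_ex f0.
  pose g (t : F) : {ffun position -> F} := [ffun x => t * f x].
  have g_inj : injective g.
    by move=> t t' /ffunP/(_ x); rewrite !ffunE; apply: mulIf.
  have gE t c' i : parity c' (g t) i = t *: parity c' f i.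
    rewrite -[RHS]addr0 -(parity0 c' i); apply: parity_linear => y.
    by rewrite !ffunE addr0.
  rewrite -big_mkcondr /= sum1_card.
  rewrite -[X in (X <= _)%N](_ : #|[set g t | t in [set~ 0]]| = _).
    apply: subset_leq_card; apply/subsetP => _ /imsetP[t t0 ->].
    rewrite !inE in t0; rewrite unfold_in inE -andbA; apply/and3P; split.
    - by apply/word_suppP => y /fC fy; rewrite ffunE fy mulr0.
    - apply/forallP => y.
      (* Dividing the target by [t] carries surjectivity from [f] to [g t]. *)
      have /existsP[c' /forall_inP c'P] := forallP fZ [ffun i => t^-1 *: y i].
      apply/existsP; exists c'; apply/forall_inP => i Zi.
      by rewrite gE (eqP (c'P i Zi)) ffunE scalerA divff // scale1r.
    - by apply/forall_inP => i Zi; rewrite gE (eqP (forall_inP cf i Zi)) scaler0.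
  by rewrite card_imset // cardsC1.
apply: (@leq_trans (#|S| * #|{: erlc F T u v Delta}|)); last first.
  by rewrite mulnC leq_mul2l leS orbT.
apply: (@leq_trans ((\sum_(f in S) #|[set c : erlc F T u v Delta | vanishes c f p.2]|)
                      * #|F| ^ (u * #|p.2|))).
  rewrite leq_mul2r; apply/orP; right.
  rewrite -sum_nat_const (leq_trans (leq_sum _ scale)) // exchange_big /=.
  apply: leq_sum => f _; rewrite -big_mkcondr /= sum1_card.
  by apply: subset_leq_card; apply/subsetP => c; rewrite !inE => /andP[].
rewrite big_distrl /= -sum_nat_const; apply: leq_sum => f.
by rewrite inE => /andP[_ /card_vanishes].
Qed.

Definition generic c := [forall p, c \notin failures p].

Lemma genericP c (C : {set position}) Z f : generic c ->
    f != [ffun=> 0] -> word_supp C f -> (forall i, i \in Z -> triangular f i) ->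
    (#|C| <= u * #|Z|)%N ->
  ~ forall i, i \in Z -> parity c f i = 0.
Proof.
move=> /forallP/(_ (C, Z)) gc f0 fC fZ leC cf.
move: gc; rewrite inE leC /= negb_exists => /forallP/(_ f); apply/negP.
rewrite negbK f0 fC triangular_onto //=.
by apply/forall_inP => i Zi; rewrite cf.
Qed.

Lemma card_nongeneric :
  (#|[set c | ~~ generic c]| * #|F|.-1 <=
     #|{: {set position} * {set 'I_T.+1}}| * #|{: erlc F T u v Delta}|)%N.
Proof.
have -> : [set c | ~~ generic c] = \bigcup_p failures p.
  apply/setP => c; rewrite inE negb_forall; apply/existsP/bigcupP.
    by move=> [p]; rewrite negbK => cp; exists p.
  by move=> [p _ cp]; exists p; rewrite negbK.
apply: (@leq_trans ((\sum_p #|failures p|) * #|F|.-1)).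
  rewrite leq_mul2r; apply/orP; right.
  elim/big_rec2: _ => [|p m A _ leA]; first by rewrite cards0.
  by rewrite (leq_trans (leq_card_setU _ _)) // leq_add2l.
rewrite big_distrl /= -sum_nat_const; apply: leq_sum => p _.
exact: card_failures.
Qed.

End Parity.

(** * Probability of genericity for large fields *)

Lemma prob_generic (T u v Delta : nat) (eps : rat) : 0 < eps ->
  exists q0 : nat, forall F : finFieldType, (q0 <= #|F|)%N ->
    1 - eps <= uniform_prob (fun c : erlc F T u v Delta => generic c).
Proof.
move=> eps0; set M := #|{: {set position T u v} * {set 'I_T.+1}}|.
(* [M] does not depend on the field, and the failure probability is at most [M / (#|F| - 1)]. *)
exists (Num.bound (M%:R / eps)).+2 => F leF.
have := card_nongeneric F T u v Delta; rewrite -/M.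
set X := #|{: erlc F T u v Delta}|; set B := #|_| => leB.
have X0 : (0 < X)%N by apply/card_gt0P; exists 0.
have GB : #|fun c : erlc F T u v Delta => generic c| = (X - B)%N.
  rewrite /X -(cardC (fun c : erlc F T u v Delta => generic c)).
  rewrite [B](_ : _ = #|[predC (fun c : erlc F T u v Delta => generic c)]|) ?addnK //.
  by rewrite /B cardsE; apply: eq_card.
have leBX : (B <= X)%N by apply: max_card.
rewrite /uniform_prob GB -/X natrB // mulrBl divff ?pnatr_eq0 -?lt0n //.
rewrite lerD2l lerN2 ler_pdivrMr ?ltr0n //.
have M_lt : M%:R / eps < (#|F|.-1)%:R :> rat.
  apply: lt_le_trans (archi_boundP _) _; first by rewrite divr_ge0 // ltW.
  by rewrite ler_nat; lia.
rewrite ltr_pdivrMr // in M_lt.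
have q1 : 0 < (#|F|.-1)%:R :> rat by rewrite ltr0n; lia.
rewrite -(ler_pM2r q1) -natrM.
apply: (@le_trans _ _ (M * X)%:R); first by rewrite ler_nat.
by rewrite natrM mulrAC [eps * _]mulrC ler_pM2r ?ltr0n // ltW.
Qed.

Lemma card_ord_interval n a b :
  #|[set i : 'I_n | (a <= i < b)%N]| = (minn b n - a)%N.
Proof.
rewrite -sum1dep_card big_mkcond /=.
elim: n => [|n IHn]; first by rewrite big_ord0; lia.
by rewrite big_ord_recr /= IHn; case: ifP; lia.
Qed.

(** * Weights under a generic code *)

Section ColumnDistance.
Variables (F : finFieldType) (T u v Delta : nat).
Variable (c : erlc F T u v Delta).
Implicit Types (f : {ffun position T u v -> F}) (A B E : {set 'I_T.+1}).

Lemma word_eq0 f i : (word f i == 0) = [forall x, f (i, x) == 0].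
Proof.
rewrite ffunE; apply/eqP/forallP => [fi [j|j]|fi].
- by have /rowP/(_ j) := congr1 fst fi; rewrite !mxE => ->.
- by have /rowP/(_ j) := congr1 snd fi; rewrite !mxE => ->.
- by congr pair; apply/rowP => j; rewrite !mxE (eqP (fi _)).
Qed.

Lemma channel_packet_eq0 f (i : 'I_T.+1) :
  (channel_packet c (source_stream (word f)) i%:Z == 0)
    = (word f i == 0) && (parity c f i == 0).
Proof.
rewrite /channel_packet source_stream_nat /parity.
set p := _ + _; case: (word f i) => a b /=.
have -> : ((a, b) == 0 :> packet F u v) = (a == 0) && (b == 0) by [].
by rewrite !row_mx_eq0.
Qed.

Definition block A B : {set position T u v} :=
  [set x | if x.2 is inl _ then x.1 \in A else x.1 \in B].

Lemma card_block A B : #|block A B| = (u * #|A| + v * #|B|)%N.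
Proof.
pose P (i : 'I_T.+1) (y : 'I_u + 'I_v) := if y is inl _ then i \in A else i \in B.
rewrite -sum1dep_card -(pair_big_dep predT P (fun _ _ => 1%N)) /=.
have inner i : (\sum_(y | P i y) 1 = u * (i \in A) + v * (i \in B))%N.
  rewrite big_sumType /=; congr (_ + _)%N; case: (i \in _).
  - by rewrite sum_nat_const card_ord.
  - by rewrite big_pred0_eq muln0.
  - by rewrite sum_nat_const card_ord.
  - by rewrite big_pred0_eq muln0.
rewrite (eq_bigr _ (fun i _ => inner i)).
by rewrite big_split /= -!big_distrr /= -!big_mkcond /= !sum1_card.
Qed.

Lemma first_v f k j : f (k, inr j) != 0 ->
  exists2 l : 'I_T.+1, (l <= k)%N /\ (exists j, f (l, inr j) != 0) &
    forall (m : 'I_T.+1) j, (m < l)%N -> f (m, inr j) = 0.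
Proof.
move=> fkj; pose P (i : 'I_T.+1) := [exists j, f (i, inr j) != 0].
have Pk : P k by apply/existsP; exists j.
case: (arg_minnP (fun i : 'I_T.+1 => nat_of_ord i) Pk) => l /existsP Pl lmin.
exists l; first by split; [exact: lmin|].
move=> m j' ltm; apply/eqP; apply: contraLR ltm => fm; rewrite -leqNgt.
by apply: lmin; apply/existsP; exists j'.
Qed.

Hypothesis u_gt0 : (0 < u)%N.
Hypothesis T_gt0 : (0 < T)%N.
Hypothesis Delta_le : (Delta <= T)%N.
Hypothesis Delta_ge : ((u + v) * (T + 1) <= Delta * (2 * u + v))%N.
Hypothesis c_gen : generic c.

Let N := (u * (T - Delta) %/ (u + v))%N.

Let N_le : (N * (u + v) <= u * (T - Delta))%N.
Proof. exact: leq_trunc_div. Qed.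

Let Delta_half : (T + 1 <= 2 * Delta)%N.
Proof. by nia. Qed.

(** The count for [v[0] != 0]: even [N.+1] erasures before [Delta] leave enough parities there. *)
Let N_window : ((u + v) * N.+1 <= u * Delta)%N.
Proof. by nia. Qed.

(** * Lower bound on the weight *)

Lemma weight_lower f : word f ord0 != 0 -> (N + 2 <= weight c (word f))%N.
Proof.
move=> f0; rewrite /weight; set E := [set _ | _]; rewrite leqNgt; apply/negP => ltE.
have fE (i : 'I_T.+1) x : i \notin E -> f (i, x) = 0.
  by rewrite inE negbK channel_packet_eq0 word_eq0 => /andP[/forallP/(_ x)/eqP].
have pE (i : 'I_T.+1) : i \notin E -> parity c f i = 0.
  by rewrite inE negbK channel_packet_eq0 => /andP[_ /eqP].
have E0 : ord0 \in E by rewrite inE channel_packet_eq0 (negPf f0).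
(* Each [C] below drops only symbols that vanish or that the chosen parities do not read. *)
pose restr (C : {set position T u v}) : {ffun position T u v -> F} :=
  [ffun x => if x \in C then f x else 0].
have restrC C : word_supp C (restr C).
  by apply/word_suppP => x /negPf nx; rewrite ffunE nx.
have ex_neq0 (C : {set position T u v}) x : x \in C -> f x != 0 -> restr C != [ffun=> 0].
  by move=> Cx; apply: contra_neq => /ffunP/(_ x); rewrite !ffunE Cx.
clearbody E.
have [/existsP[j f0j]|v0] := boolP [exists j, f (ord0, inr j) != 0].
  (* Before [Delta] the parities read no [u], so only [v] symbols are free. *)
  pose W := [set i : 'I_T.+1 | (0 <= i < Delta)%N].
  pose C := block set0 (W :&: E).
  have restr_v (i : 'I_T.+1) j' : (i < Delta)%N -> restr C (i, inr j') = f (i, inr j').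
    move=> lti; rewrite ffunE !inE /= lti.
    by case: ifP => // /negbT/fE ->.
  apply: (@genericP _ _ _ _ _ c C (W :\: E) (restr C)) => //.
  - by apply: (ex_neq0 _ (ord0, inr j)); rewrite // !inE /= E0; lia.
  - move=> i; rewrite !inE /= => /andP[nEi ltiD].
    apply: (@triangular_G _ _ _ _ _ _ ord0) => //.
    + by exists j; rewrite restr_v //=; lia.
    + rewrite lt0n; apply: contraNneq nEi => i0.
      by rewrite (_ : i = ord0) //; apply: val_inj.
    + by lia.
  - rewrite card_block cards0 muln0 add0n.
    have := cardsID E W; rewrite card_ord_interval.
    have : (#|W :&: E| <= #|E|)%N by rewrite subset_leq_card ?subsetIr.
    by move: #|W :&: E| #|W :\: E| => a b; nia.
  - move=> i; rewrite !inE /= => /andP[nEi ltiD]; rewrite -(pE _ nEi).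
    apply: parity_congr => l j' lel; last by exfalso; lia.
    by rewrite restr_v //; lia.
have {}v0 j : f (ord0, inr j) = 0.
  by apply/eqP; apply: contraNT v0 => fj; apply/existsP; exists j.
have [j0 f0j0] : exists j, f (ord0, inl j) != 0.
  move: f0; rewrite word_eq0 => /forallPn[[j|j] fj]; first by exists j.
  by rewrite v0 eqxx in fj.
(* The cap at [Delta] is harmless: from there on [u[0]] meets fresh coefficients. *)
have [k [k0 lek vk kP]] : exists k : nat, [/\ (0 < k)%N, (k <= Delta)%N,
    (forall (l : 'I_T.+1) j, (l < k)%N -> f (l, inr j) = 0) &
    k = Delta \/ exists2 l : 'I_T.+1, nat_of_ord l = k & exists j, f (l, inr j) != 0].
  have [/existsP[l /andP[ltl /existsP[j fj]]]|nv] :=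
      boolP [exists l : 'I_T.+1, (l < Delta)%N && [exists j, f (l, inr j) != 0]].
    have [k [lekl [j' fk]] kmin] := first_v fj.
    exists k; split=> //; [|lia|by right; exists k => //; exists j'].
    rewrite lt0n; apply: contraNneq fk => k0.
    by rewrite (_ : k = ord0) ?v0 //; apply: val_inj.
  exists Delta; split=> //; [lia| |by left].
  move=> l j ltl; apply/eqP; apply: contraNT nv => fl; apply/existsP; exists l.
  by rewrite ltl; apply/existsP; exists j.
(* Symbols of [u] after [T - Delta] reach no parity up to time [T]. *)
pose U := [set i : 'I_T.+1 | (0 <= i < (T - Delta).+1)%N].
pose W := [set i : 'I_T.+1 | (k <= i < T.+1)%N].
pose C := block (U :&: E) (W :&: E).
have restr_v i j : restr C (i, inr j) = f (i, inr j).
  rewrite ffunE !inE /=; case: ifP => // /negbT; rewrite ltn_ord andbT negb_and.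
  by case/orP=> [|/fE ->] //; rewrite -ltnNge => /vk ->.
have restr_u (i : 'I_T.+1) j : (i <= T - Delta)%N -> restr C (i, inl j) = f (i, inl j).
  move=> lei; rewrite ffunE !inE /= ltnS lei /=.
  by case: ifP => // /negbT/fE ->.
apply: (@genericP _ _ _ _ _ c C (W :\: E) (restr C)) => //.
- by apply: (ex_neq0 _ (ord0, inl j0)); rewrite // !inE /= E0.
- move=> i; rewrite !inE /= => /andP[nEi /andP[leki _]].
  have [leDi|ltiD] := leqP Delta i.
    by apply: triangular_H => //; exists j0; rewrite restr_u.
  case: kP => [kD|[l lk [j flj]]]; first by lia.
  apply: (@triangular_G _ _ _ _ _ _ l).
  + by move=> m j'; rewrite lk restr_v => /vk.
  + by exists j; rewrite restr_v.
  (* The case [i = k] is excluded: [v[k] != 0] puts [k] in [E]. *)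
  + rewrite ltn_neqAle lk leki andbT; apply: contraNneq nEi => li.
    rewrite -(_ : l = i); last by apply: val_inj; rewrite /= lk.
    by apply: contraNT flj => /fE ->.
  + by lia.
(* An erasure costs both [u] and [v] symbols only in the overlap of [U] and [W], which has at most
   [(T - Delta).+1 - k] times. Time 0 is in [E] but not in [W], so at most [N] erasures cost [v]
   symbols. *)
- rewrite card_block.
  have := cardsID E W; rewrite card_ord_interval.
  have := cardsUI (U :&: E) (W :&: E).
  have : (#|U :&: E :|: W :&: E| <= #|E|)%N.
    by rewrite subset_leq_card // subUset !subsetIr.
  have : (#|U :&: E :&: (W :&: E)| <= (T - Delta).+1 - k)%N.
    apply: leq_trans (_ : #|[set i : 'I_T.+1 | (k <= i < (T - Delta).+1)%N]| <= _)%N.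
      apply: subset_leq_card; apply/subsetP => i; rewrite !inE.
      by move=> /andP[/andP[/andP[_ ->] _] /andP[/andP[-> _] _]].
    by rewrite card_ord_interval; lia.
  have : (#|W :&: E| < #|E|)%N.
    rewrite (cardsD1 ord0 E) E0 ltnS subset_leq_card //.
    apply/subsetP => i; rewrite !inE => /andP[/andP[leki _] ->].
    by rewrite andbT; apply: contraTneq leki => ->; rewrite /= -ltnNge.
  move: #|U :&: E| #|W :&: E| #|W :\: E| #|_ :|: _| #|_ :&: (_ :&: _)| #|E| ltE.
  move=> a b z un it e ltE ltb leit leun eq1 eq2.
  have leeN : (e <= N.+1)%N by lia.
  have h1 : (u * (a + b) <= u * (N.+1 + ((T - Delta).+1 - k)))%N.
    by rewrite leq_mul2l -eq1; apply/orP; right; lia.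
  have h2 : (v * b <= v * N)%N by rewrite leq_mul2l; apply/orP; right; lia.
  have h3 : (u * (b + z) = u * (T.+1 - k))%N by congr (_ * _)%N; lia.
  (* If [k <= T - Delta] this is [Delta_half]; otherwise the truncated difference is 0 and
     [k <= Delta] suffices. *)
  have h4 : (u * ((T - Delta) + 1 + ((T - Delta).+1 - k)) <= u * (T.+1 - k))%N.
    by rewrite leq_mul2l; apply/orP; right; lia.
  move: h1 h2 h3 h4 N_le; clear.
  move: (T - Delta)%N ((T - Delta).+1 - k)%N (T.+1 - k)%N N => t m w n.
  lia.
- move=> i; rewrite !inE /= => /andP[nEi _]; rewrite -(pE _ nEi).
  apply: parity_congr => l j lel; first by rewrite restr_v.
  by rewrite restr_u //; have := ltn_ord i; lia.
Qed.

(** * A word attaining the bound *)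

Lemma weight_upper : exists2 f, word f ord0 != 0 & (weight c (word f) <= N + 2)%N.
Proof.
have N_leT : (N <= T - Delta)%N.
  rewrite -(@leq_pmul2r (u + v)) ?addn_gt0 ?u_gt0 //.
  by rewrite (leq_trans N_le) // mulnC leq_mul2l leq_addr orbT.
have ltN : (u * (T - Delta) < (u + v) * N.+1)%N 
  by rewrite [X in (_ < X)%N]mulnC; apply: ltn_ceil; rewrite addn_gt0 u_gt0.
pose W := [set i : 'I_T.+1 | (Delta <= i < Delta + N.+1)%N].
pose Z := [set i : 'I_T.+1 | (Delta + N.+1 <= i < T.+1)%N].
have cardW : #|W| = N.+1 by rewrite card_ord_interval; lia.
have cardZ : #|Z| = (T - Delta - N)%N by rewrite card_ord_interval; lia.
(* With the [u] symbols of [u[0]], this exceeds the [u * #|Z|] equations by one. If [Z] is empty,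
   truncation gives 0 and [u[0]] alone suffices. [ltN] ensures that [W] has [d] symbols of [v]. *)
pose d := (u * #|Z| + 1 - u)%N.
have [Cv CvW cardCv] :
    exists2 Cv : {set position T u v}, Cv \subset block set0 W & #|Cv| = d.
  have le_d : (d <= #|block set0 W|)%N.
    by rewrite card_block cards0 muln0 cardW /d cardZ; nia.
  exists [set x in take d (enum (block set0 W))].
    by apply/subsetP => x; rewrite inE => /mem_take; rewrite mem_enum.
  rewrite cardsE (card_uniqP _) ?take_uniq ?enum_uniq // size_takel //.
  by rewrite -cardE.
have CvP i y : (i, y) \in Cv -> i \in W /\ exists j, y = inr j.
  move=> /(subsetP CvW); rewrite inE /=.
  by case: y => [j|j]; rewrite ?inE // => Wi; split=> //; exists j.
pose C := block [set ord0] set0 :|: Cv.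
have cardC : #|C| = (u + d)%N.
  rewrite cardsU cardCv card_block cards0 cards1 muln0 muln1 addn0.
  rewrite (_ : _ :&: _ = set0) ?cards0 ?subn0 //.
  apply/setP => -[i y]; rewrite !inE /=; apply/negP => /andP[yi /CvP[_ [j yj]]].
  by rewrite yj in yi.
pose S : {set {ffun position T u v -> F}} := [set f | word_supp C f].
pose phi (f : {ffun position T u v -> F}) : {ffun 'I_T.+1 -> 'rV[F]_u} :=
  [ffun i => if i \in Z then parity c f i else 0].
(* Pigeonhole: two words supported on [C] share their parities on [Z], and their difference is the
   solution [h]. *)
have : ~~ dinjectiveb phi (mem S).
  apply/negP => /dinjectiveP phi_inj.
  have := card_in_imset phi_inj; rewrite card_word_supp cardC => eqS.
  pose Y := [set y : {ffun 'I_T.+1 -> 'rV[F]_u} | y \in pffun_on 0 Z predT].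
  have : (#|phi @: S| <= #|Y|)%N.
    apply: subset_leq_card; apply/subsetP => _ /imsetP[f _ ->]; rewrite inE.
    apply/pffun_onP; split=> //; apply/supportP => i /negPf nZ.
    by rewrite ffunE nZ.
  rewrite eqS cardsE card_pffun_on card_mx mul1n -expnM leq_exp2l ?card_finNzRing_gt1 //.
  by rewrite /d; lia.
move=> /dinjectivePn[f Sf [g /andP[/= neq_gf Sg] eq_fg]].
pose h : {ffun position T u v -> F} := [ffun x => -1 * f x + g x].
have h0 : h != [ffun=> 0].
  apply: contraNneq neq_gf => /ffunP h0; apply/eqP/ffunP => x.
  by have := h0 x; rewrite !ffunE mulN1r addrC => /eqP; rewrite subr_eq0 => /eqP.
have hC x : x \notin C -> h x = 0.
  move=> nx; move: Sf Sg; rewrite !inE => /word_suppP fC /word_suppP gC.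
  by rewrite ffunE fC // gC // mulr0 addr0.
have hZ i : i \in Z -> parity c h i = 0.
  move=> Zi; rewrite (@parity_linear _ _ _ _ _ c (-1) f g h i); last first.
    by move=> x; rewrite ffunE.
  have /ffunP/(_ i) := eq_fg; rewrite !ffunE Zi => ->.
  by rewrite scaleN1r addNr.
have hv (i : 'I_T.+1) j : h (i, inr j) != 0 -> (Delta <= i < Delta + N.+1)%N.
  move=> hi; have : (i, inr j) \in C by apply: contraNT hi => /hC ->.
  by rewrite !inE /= => /CvP[]; rewrite inE.
exists h.
  (* If [h] vanished at time 0, it would live on [Cv], with at most [u * #|Z|] symbols. Its first
     nonzero [v] precedes all of [Z], so genericity is contradicted. *)
  rewrite word_eq0; apply/negP => /forallP hw.
  have hCv : word_supp Cv h.
    apply/word_suppP => -[i y] nCv; have [|/hC//] := boolP ((i, y) \in C).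
    rewrite !inE (negPf nCv) orbF /=; case: y {nCv} => [j|j]; rewrite ?inE // => /eqP ->.
    exact/eqP/hw.
  apply: (genericP c_gen h0 hCv _ _ hZ) => [i|]; last first.
    rewrite cardCv /d; move: (u * #|Z|)%N => m; lia.
  rewrite inE ltn_ord andbT => leNi.
  have [[k y] hk] := neq0_ex h0.
  have [_ [j yj]] : k \in W /\ exists j, y = inr j.
    by apply: CvP; apply: contraNT hk => /(word_suppP _ _ hCv) ->.
  rewrite {}yj in hk; have [l [_ [j' hl]] lP] := first_v hk.
  have := hv _ _ hl => leDl.
  by apply: (@triangular_G _ _ _ _ _ _ l) => //; [exists j' | | ]; have := ltn_ord i; lia.
rewrite addn2 -cardW -add1n -(cards1 (ord0 : 'I_T.+1)).
apply: leq_trans (leq_card_setU _ _); apply: subset_leq_card.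
apply/subsetP => i; rewrite !inE channel_packet_eq0; apply: contraR.
rewrite negb_or => /andP[i0 nW].
have hi x : h (i, x) = 0.
  apply: hC; rewrite !inE /= negb_or; apply/andP; split.
    by case: x => j; rewrite ?inE.
  by apply/negP => /CvP[]; rewrite inE (negPf nW).
rewrite word_eq0; apply/andP; split; first by apply/forallP => x; rewrite hi.
have [Zi|nZi] := boolP (i \in Z); first by rewrite hZ.
(* Here [i < Delta], too early for the parity to read [u[0]] or any [v] in [W]. *)
rewrite -(parity0 c i); apply/eqP; apply: parity_congr => l j lel; rewrite [RHS]ffunE.
  apply/eqP; apply: contraNT nZi => /hv; rewrite inE ltn_ord; lia.
by exfalso; move: nZi; rewrite inE ltn_ord; lia.
Qed.

End ColumnDistance.

(** * From weights to the column distance and the rate formula *)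

Lemma bigmin_nat_le (I : eqType) (r : seq I) (P : pred I) (G : I -> nat) m i :
  i \in r -> P i -> (\big[minn/m]_(j <- r | P j) G j <= G i)%N.
Proof.
elim: r => //= j r IHr; rewrite inE big_cons => /predU1P[<-|ir] Pi.
  by rewrite Pi geq_minl.
by case: ifP => _; rewrite ?geq_min ?IHr ?orbT.
Qed.

Lemma generic_column_distance (F : finFieldType) (T u v Delta : nat)
    (c : erlc F T u v Delta) :
    (0 < u)%N -> (0 < T)%N -> (Delta <= T)%N ->
    ((u + v) * (T + 1) <= Delta * (2 * u + v))%N -> generic c ->
  column_distance c = (u * (T - Delta) %/ (u + v) + 2)%N.
Proof.
move=> u0 T0 DT DR gc; apply/eqP; rewrite eqn_leq; apply/andP; split.
  have [f f0 fw] := weight_upper u0 T0 DT DR gc.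
  by apply: leq_trans fw; apply: bigmin_nat_le; rewrite ?mem_index_enum.
rewrite /column_distance; elim/big_rec: _ => [|s m s0 lem].
  (* The default [T.+1] of the minimum is also large enough, since the quotient is at most
     [T - Delta] and [Delta] is positive. *)
  have := leq_trunc_div (u * (T - Delta)) (u + v); nia.
rewrite leq_min lem andbT; have [f fs] := word_surj s.
by rewrite -fs in s0 *; apply: weight_lower.
Qed.

Lemma floor_natr_div (m d : nat) :
  (0 < d)%N -> Num.floor (m%:R / d%:R : rat) = (m %/ d)%N%:Z.
Proof.
move=> d0; have d0' : 0 < d%:R :> rat by rewrite ltr0n.
apply: floor_def; rewrite intrD -!pmulrn -natrD.
rewrite ler_pdivlMr // ltr_pdivrMr // -!natrM ler_nat ltr_nat.
by rewrite leq_trunc_div addn1 ltn_ceil.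
Qed.

Theorem proposition2 (T u v Delta : nat)
    (T_ge1 : (1 <= T)%N) (u_ge1 : (1 <= u)%N) (Delta_leT : (Delta <= T)%N)
    (rate_ge_half : 1 / 2 <= rate u v)
    (Delta_ge : rate u v * (T + 1)%:R <= Delta%:R) :
  forall eps : rat, 0 < eps ->
  exists q0 : nat, forall F : finFieldType, (q0 <= #|F|)%N ->
    1 - eps <=
    uniform_prob (fun c : erlc F T u v Delta =>
      (column_distance c)%:Z ==
        Num.floor ((1 - rate u v) / rate u v * (T%:R - Delta%:R) + 2)).
Proof.
have q2 : (0 : rat) < (2 * u + v)%:R by rewrite ltr0n; lia.
have q1 : (0 : rat) < (u + v)%:R by rewrite ltr0n; lia.
have Delta_nat : ((u + v) * (T + 1) <= Delta * (2 * u + v))%N.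
  move: Delta_ge; rewrite /rate mulrAC ler_pdivrMr //.
  by rewrite -!natrM ler_nat.
have floorE : Num.floor ((1 - rate u v) / rate u v * (T%:R - Delta%:R) + 2)
    = (u * (T - Delta) %/ (u + v) + 2)%N%:Z.
  (* With [R] the rate, [(1 - R) / R = u / (u + v)]. *)
  have -> : (1 - rate u v) / rate u v * (T%:R - Delta%:R) + 2
      = (u * (T - Delta))%:R / (u + v)%:R + 2 :> rat.
    congr (_ + _); rewrite /rate natrM natrB // [RHS]mulrAC; congr (_ * _).
    rewrite !natrD ?natrM in q1 q2 *.
    by field; rewrite addr0 in q2; rewrite !lt0r_neq0.
  by rewrite floorDrz ?rpred_nat //= floor_natr_div ?addn_gt0 ?u_ge1 // floor_nat.
move=> eps /(prob_generic T u v Delta)[q0 q0P]; exists q0 => F /q0P.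
move/le_trans; apply; rewrite /uniform_prob ler_pM2r; last first.
  by rewrite invr_gt0 ltr0n; apply/card_gt0P; exists 0.
rewrite ler_nat; apply: subset_leq_card; apply/subsetP => c gc.
by rewrite unfold_in /= floorE (generic_column_distance _ _ _ _ gc).
Qed.
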